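(* Let $n\ge2$, $b\ge2$. Let $\mu_1,\mu_2,\dots$ be i.i.d. random permutations in $S_n$ with law $Q_b$, and define $\tau_0=\mathrm{id}$ and $\tau_r=\tau_{r-1}\circ\mu_r$ (i.e. $\tau_r(p)=\tau_{r-1}(\mu_r(p))$), the arrangement after $r$ successive $b$-shuffles. Then $(d(\tau_r^{-1}))_{r\ge0}$ is a Markov chain on $\{0,\dots,n-1\}$ with stationary distribution $\pi(j)=A(n,j)/n!$, and its transition matrix $K$ satisfies $K(i,j)=\pi(j)P_b(j,i)/\pi(i)$ for all $i,j$; that is, the formal time reversal of this chain with respect to $\pi$ is exactly the base-$b$ carries chain $P_b$.
   Context: For $\sigma\in S_n$, $\sigma$ has a descent at $i$ ($1\le i\le n-1$) if $\sigma(i+1)<\sigma(i)$; $d(\sigma)$ is the number of descents, and $A(n,j)$ (Eulerian number) is the number of $\sigma\in S_n$ with $d(\sigma)=j$. Binomial convention: $\binom{m}{n}=\frac{m(m-1)\cdots(m-n+1)}{n!}$ if $m\ge n$, and $0$ if $m<n$. The $b$-shuffle measure is $Q_b(\sigma)=\binom{n+b-d(\sigma^{-1})-1}{n}/b^n$ on $S_n$. The base-$b$ carries chain for adding $n$ numbers is the Markov chain on $\{0,\dots,n-1\}$ given by $\kappa_0=0$, $\kappa_{t+1}=\lfloor(\kappa_t+X_{t+1,1}+\dots+X_{t+1,n})/b\rfloor$ with $X_{t,k}$ i.i.d. uniform on $\{0,\dots,b-1\}$; its transition matrix is $P_b(i,j)=b^{-n}\sum_{l=0}^{j-\lfloor i/b\rfloor}(-1)^l\binom{n+1}{l}\binom{n-1-i+(j+1-l)b}{n}$.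 *)

(* Defs.v *)
From HB Require Import structures.
From mathcomp Require Import all_boot all_order all_algebra all_fingroup.
Set Implicit Arguments. Unset Strict Implicit. Unset Printing Implicit Defensive.
Import Order.TTheory GRing.Theory Num.Theory.

(* Positions 1..n of the paper are the ordinals 0..n-1 here. *)

Definition descents (n : nat) (s : 'S_n) : nat :=
  #|[pred i : 'I_n | [exists j : 'I_n, (val j == (val i).+1) && (s j < s i)]]|.

Definition eulerian (n j : nat) : nat := #|[pred s : 'S_n | descents s == j]|.

Local Open Scope ring_scope.

Definition pi_eul (n : nat) (j : nat) : rat := (eulerian n j)%:R / (n`!)%:R.

(* b-shuffle measure Q_b(sigma) = C(n+b-d(sigma^-1)-1, n) / b^n.
   (Here n+b-d-1 >= 0 always since d <= n-1, so the nat binomial is the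
   paper's convention.) *)
Definition Qb (n b : nat) (s : 'S_n) : rat :=
  ('C(n + b - descents (s^-1)%g - 1, n))%:R / (b ^ n)%:R.

(* Carries chain P_b(i,j) = b^-n sum_{l=0}^{j - floor(i/b)} (-1)^l C(n+1,l)
   C(n-1-i+(j+1-l)b, n); the sum is empty when j < floor(i/b). *)
Definition Pb (n b : nat) (i j : nat) : rat :=
  (\sum_(l < (j.+1 - i %/ b)%N)
     (-1) ^+ l * ('C(n.+1, l))%:R * ('C(n - 1 - i + (j.+1 - l) * b, n))%:R)
  / (b ^ n)%:R.

(* tau_k for the shuffle sequence mu = [mu_1; ...; mu_r]:
   tau_0 = id, tau_k = tau_{k-1} o mu_k.  In mathcomp (s * t) x = t (s x),
   so tau_{k-1} o mu_k = mu_k * tau_{k-1}. *)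
Definition tau (n : nat) (mu : seq 'S_n) (k : nat) : 'S_n :=
  foldl (fun t m => (m * t)%g) 1%g (take k mu).

(* P(d(tau_0^-1) = js_0, ..., d(tau_r^-1) = js_r) where r+1 = size js,
   mu_1..mu_r i.i.d. with law Q_b. *)
Definition pathprob (n b : nat) (js : seq 'I_n) : rat :=
  \sum_(mu : ((size js).-1).-tuple 'S_n)
     (\prod_(m <- mu) Qb b m) *
     (if [forall k : 'I_(size js), descents (tau mu k)^-1 == nth 0%N (map val js) k]
      then 1 else 0).

(* Main.v *)
Require Import Defs.
From HB Require Import structures.
From mathcomp Require Import all_boot all_order all_algebra all_fingroup.
From mathcomp Require Import zify ring.
Import Order.TTheory GRing.Theory Num.Theory.
Set Implicit Arguments. Unset Strict Implicit. Unset Printing Implicit Defensive.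

(** The standardization [std g] of a word [g : [n] -> [c]] ranks the positions
    [p] by [(g p, p)]. Exactly [C(n + c - 1 - d(s^-1), n)] words over [[c]]
    standardize to [s], so [Q_b] is the law of [std g] for a uniform word [g]
    over [[b]]. Merging a word [g] over [[b]] and a word [h] over [[a]] into
    the word [p |-> h (std g p) * b + g p] over [[a * b]] multiplies the
    standardizations. Hence the numbers [N_c(s)] of words over [[c]] with
    standardization [s] satisfy [sum_t N_b(s t^-1) N_a(t) = N_ab(s)].
    Inverting a binomial sum writes the indicator of [d(t^-1) = i] as
    [sum_l (-1)^l C(n+1, l) N_(i+1-l)(t)], and therefore the sum of
    [Q_b(s t^-1)] over the [t] with [d(t^-1) = i] is [P_b(d(s^-1), i)]. As this
    depends on [s] only through [d(s^-1)], [tau_r] stays uniform on inverse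
    descent classes along any path of the chain; the Markov property, the
    formula for [K], and the remaining claims follow by summation. *)

(** * Standardization of words and the merging of words *)

Section Standardization.
Variable n : nat.
Implicit Types (g : 'I_n -> nat) (s t : 'S_n).

Definition lex_lt g (p q : 'I_n) : bool :=
  (g p < g q) || ((g p == g q) && (p < q)).

Lemma lex_ltnn g p : lex_lt g p p = false.
Proof. by rewrite /lex_lt !ltnn andbF. Qed.

Lemma lex_lt_trans g : transitive (lex_lt g).
Proof. by rewrite /lex_lt => q p r; lia. Qed.

Lemma lex_lt_total g p q : p != q -> lex_lt g p q = ~~ lex_lt g q p.
Proof. by rewrite /lex_lt -(inj_eq val_inj) /= => ?; lia. Qed.

Definition lex_rank g (p : 'I_n) : nat := #|[pred q | lex_lt g q p]|.

Lemma lex_rank_mono g p q : lex_lt g p q -> lex_rank g p < lex_rank g q.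
Proof.
move=> pq; apply: proper_card; apply/properP; split.
  by apply/subsetP=> r; rewrite !inE => /lex_lt_trans; apply.
by exists p; rewrite !inE ?lex_ltnn.
Qed.

Lemma lex_rank_lt g p : lex_rank g p < n.
Proof.
rewrite -[X in _ < X]card_ord; apply: proper_card; apply/properP; split.
  exact/subsetP.
by exists p; rewrite // inE lex_ltnn.
Qed.

Lemma lex_rank_inj g : injective (fun p => Ordinal (lex_rank_lt g p)).
Proof.
move=> p q /(congr1 val) /= pq; apply/eqP; apply: contraTT isT => npq.
have := lex_lt_total g npq; case: (boolP (lex_lt g q p)) => [/lex_rank_mono|_ /lex_rank_mono];
  by rewrite pq ltnn.
Qed.

Definition std g : 'S_n := perm (@lex_rank_inj g).

Lemma std_ltE g p q : (std g p < std g q) = lex_lt g p q.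
Proof.
rewrite !permE /=; case: (eqVneq p q) => [->|npq]; first by rewrite ltnn lex_ltnn.
case: (boolP (lex_lt g p q)) => [/lex_rank_mono ->//|].
have nqp : q != p by rewrite eq_sym.
by rewrite -(lex_lt_total g nqp) => /lex_rank_mono; lia.
Qed.

Lemma card_ltn_ord (i : 'I_n) : #|[pred k : 'I_n | k < i]| = i.
Proof.
rewrite -sum1_card -(big_ord_widen _ (fun=> 1)) ?sum1_card ?card_ord //.
exact: ltnW.
Qed.

(** The value at [p] is the number of [q] with a smaller image, so the order of the images
    determines the permutation. *)
Lemma perm_ltn_inj s t :
  (forall p q, (s p < s q) = (t p < t q)) -> s = t.
Proof.
have rk (u : 'S_n) p : #|[pred q | u q < u p]| = u p :> nat.
  rewrite -[RHS]card_ltn_ord -(card_image (@perm_inj _ u)); apply: eq_card => k.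
  by rewrite -[k](permKV u) mem_image ?inE //; apply: perm_inj.
move=> st; apply/permP => p; apply: val_inj; rewrite /= -(rk s p) -(rk t p).
by apply: eq_card => q; rewrite !inE st.
Qed.

Lemma std_unique g s : (forall p q, (s p < s q) = lex_lt g p q) -> std g = s.
Proof. by move=> H; apply: perm_ltn_inj => p q; rewrite std_ltE H. Qed.

(** Since [g p < b], the digit [h (std g p)] decides first. On a tie, comparing [g] and then the
    position is comparing [std g], which is the tie rule of [std h] at the positions [std g p]. *)
Lemma std_comp b g h (gb : forall p, g p < b) :
  std (fun p => h (std g p) * b + g p) = (std g * std h)%g.
Proof.
apply: std_unique => p q; rewrite !permM std_ltE /lex_lt std_ltE /lex_lt.
have := gb p; have := gb q; move: (g p) (g q) => x y yb xb.
case: (ltngtP (h (std g p)) (h (std g q))) => [hlt|hlt|->] /=.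
- by have -> : h (std g p) * b + x < h (std g q) * b + y by nia.
- suff : h (std g q) * b + y < h (std g p) * b + x by lia.
  by nia.
- by rewrite ltn_add2l eqn_add2l.
Qed.

Definition nstd (c : nat) s : nat :=
  #|[pred g : {ffun 'I_n -> 'I_c} | std (fun p => g p) == s]|.

Lemma sum_nstd c : \sum_s nstd c s = c ^ n.
Proof.
rewrite -[RHS](_ : #|{ffun 'I_n -> 'I_c}| = _); last by rewrite card_ffun !card_ord.
rewrite -sum1_card.
rewrite (partition_big (fun g : {ffun 'I_n -> 'I_c} => std (fun p => g p)) xpredT) //=.
by apply: eq_bigr => s _; rewrite sum1_card; apply: eq_card.
Qed.

Lemma merge_subproof a b (i : 'I_a) (j : 'I_b) : i * b + j < a * b.
Proof. by have := ltn_ord i; have := ltn_ord j; nia. Qed.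

Definition merge a b (gh : {ffun 'I_n -> 'I_b} * {ffun 'I_n -> 'I_a})
    : {ffun 'I_n -> 'I_(a * b)} :=
  [ffun p => Ordinal (merge_subproof (gh.2 (std (fun q => gh.1 q) p)) (gh.1 p))].

(** Reduction mod [b] recovers [g], hence [std g], and the high digits then give [h]; the two sides
    have equal cardinality. *)
Lemma merge_bij a b : bijective (@merge a b).
Proof.
apply: inj_card_bij; last first.
  by rewrite card_prod !card_ffun !card_ord expnMn mulnC.
move=> [g h] [g' h'] /ffunP E.
have {}E p : h (std (fun q => g q) p) * b + g p = h' (std (fun q => g' q) p) * b + g' p.
  by have /(congr1 val) := E p; rewrite !ffunE.
have gg : g = g'.
  apply/ffunP => p; apply: val_inj; have /(congr1 (modn^~ b)) := E p.
  by rewrite /= !modnMDl !modn_small.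
rewrite -{}gg in E *; congr (_, _); apply/ffunP => k; apply: val_inj.
have /eqP := E ((std (fun q => g q))^-1%g k);
  rewrite permKV eqn_add2r eqn_pmul2r; first by move/eqP.
exact: leq_trans (ltn_ord (g k)).
Qed.

(** Through [merge], words over [a * b] become pairs with [std g * std h = s], which are sorted here
    by [t = std h]. *)
Lemma nstd_conv a b s :
  \sum_t nstd b (s * t^-1)%g * nstd a t = nstd (a * b) s.
Proof.
rewrite /nstd -[RHS]sum1_card (reindex _ (onW_bij _ (@merge_bij a b))) /=.
rewrite (eq_bigl (fun gh : {ffun 'I_n -> 'I_b} * {ffun 'I_n -> 'I_a} =>
  (std (fun p => gh.1 p) * std (fun p => gh.2 p))%g == s)); last first.
  move=> gh; rewrite inE -(@std_comp b) //; congr (_ == _); apply: std_unique => p q.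
  by rewrite std_ltE /lex_lt !ffunE.
rewrite (partition_big (fun gh : {ffun 'I_n -> 'I_b} * {ffun 'I_n -> 'I_a} =>
  std (fun p => gh.2 p)) xpredT) //=.
apply: eq_bigr => t _.
rewrite -cardX -sum1_card; apply: eq_bigl => -[g h] /=.
rewrite !inE /=; apply/andP/andP => -[/eqP e /eqP f]; split; apply/eqP => //.
  by rewrite e f mulgKV.
by rewrite -e -f mulgK.
Qed.
End Standardization.

(** * Counting the words with a given standardization *)

Definition non_descents (D : nat -> bool) (k : nat) : nat := \sum_(i < k) ~~ D i.

Lemma non_descentsS D k : non_descents D k.+1 = non_descents D k + ~~ D k.
Proof. exact: big_ord_recr. Qed.

Lemma leq_non_descents D k m : k <= m -> non_descents D k <= non_descents D m.
Proof.
move=> /subnKC <-; elim: (m - k) => [|l IH]; first by rewrite addn0.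
by rewrite addnS non_descentsS; apply: leq_trans IH (leq_addr _ _).
Qed.

(* Adding to [f i] the number of non-descents before [i] makes [f] strictly increasing. *)
Lemma card_step_words (D : nat -> bool) n c :
  #|[pred f : {ffun 'I_n.+1 -> 'I_c} |
      [forall i, forall j, (val j == (val i).+1) ==> (f i + D i <= f j)]]|
  = 'C(c + non_descents D n, n.+1).
Proof.
set P := (X in #|X| = _).
have fP (f : {ffun 'I_n.+1 -> 'I_c}) :
    reflect (forall i j : 'I_n.+1, val j = (val i).+1 -> f i + D i <= f j) (P f).
  apply: (iffP forallP) => [H i j /eqP ij|H i]; first by have /forallP/(_ j) := H i; rewrite ij.
  by apply/forallP => j; apply/implyP => /eqP; apply: H.
set e := non_descents D.
have hub (f : {ffun 'I_n.+1 -> 'I_c}) (i : 'I_n.+1) : f i + e i < c + e n.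
  have : e i <= e n by apply: leq_non_descents; rewrite -ltnS.
  by have := ltn_ord (f i); lia.
pose H (f : {ffun 'I_n.+1 -> 'I_c}) := [tuple Ordinal (hub f i) | i < n.+1].
have Hinj : injective H.
  move=> f f' /(congr1 (fun t => tnth t)) E; apply/ffunP => i; apply: val_inj.
  have /(congr1 (fun F => val (F i))) := E; rewrite !tnth_mktuple /=; lia.
rewrite -(card_ltn_sorted_tuples n.+1 (c + e n)) -(card_image Hinj).
have nthE (t : n.+1.-tuple 'I_(c + e n)) (i : 'I_n.+1) : nth 0 (map val t) i = tnth t i.
  by rewrite -(tnth_nth 0 (map_tuple val t)) tnth_map.
apply: eq_card => t; rewrite inE; apply/imageP/(sortedP 0) => [[f /fP Pf ->]|].
  move=> i; rewrite size_map size_tuple => lt.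
  rewrite (nthE _ (Ordinal (ltnW lt))) (nthE _ (Ordinal lt)) !tnth_mktuple /=.
  have := Pf (Ordinal (ltnW lt)) (Ordinal lt) erefl; rewrite /e non_descentsS /=.
  by case: (D i) => /=; lia.
rewrite size_map size_tuple => srt.
have step (i j : 'I_n.+1) : val j = (val i).+1 -> tnth t i < tnth t j.
  move=> ij; have := ltn_ord j; rewrite -!(nthE t) ij; exact: srt.
(* The preimage of [t] is [tnth t i - e i]. This bound keeps the subtraction exact; the next one,
   propagated down from the last entry, keeps the result below [c]. *)
have hge k : k < n.+1 -> e k <= nth 0 (map val t) k.
  elim: k => [|k IH] lt; first by rewrite /e /non_descents big_ord0.
  by have := srt _ lt; have := IH (ltnW lt); rewrite /e non_descentsS; case: (D k) => /=; lia.
have hle (i : 'I_n.+1) : tnth t i - e i < c.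
  suff : forall k m, k + m = n -> nth 0 (map val t) k < c + e k.
    move/(_ i (n - i) (subnKC (ltn_ord i : i <= n))); rewrite nthE.
    by have := hge i (ltn_ord i); rewrite nthE => ? ?; rewrite ltn_subLR // [e i + c]addnC.
  move=> k m; elim: m k => [|m IH] k.
    by rewrite addn0 => ->; rewrite (nthE t ord_max) ltn_ord.
  rewrite addnS -addSn => km; have := IH _ km.
  have /srt : k.+1 < n.+1 by lia.
  by rewrite /e non_descentsS; case: (D k) => /=; lia.
exists [ffun i => Ordinal (hle i)].
  apply/fP => i j ij; rewrite !ffunE /=.
  have := step _ _ ij; have := hge i (ltn_ord i); rewrite nthE ij /e non_descentsS.
  by case: (D i) => /=; lia.
apply: eq_from_tnth => i; apply: val_inj; rewrite tnth_mktuple /= ffunE /=.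
by have := hge i (ltn_ord i); rewrite nthE => /subnK.
Qed.

(** Indexed by [nat], and false out of range, so that it can serve as the [D] of [non_descents]. *)
Definition descent_at n (s : 'S_n) (k : nat) : bool :=
  [exists i : 'I_n, exists j : 'I_n, [&& val i == k, val j == k.+1 & s j < s i]].

Lemma descent_atE n (s : 'S_n) (i j : 'I_n) :
  val j = (val i).+1 -> descent_at s i = (s j < s i).
Proof.
move=> ij; apply/existsP/idP => [[i' /existsP[j' /and3P[/eqP ii /eqP jj]]]|lt].
  have -> : i' = i by apply: val_inj.
  by have -> : j' = j by apply: val_inj; rewrite ij.
by exists i; apply/existsP; exists j; rewrite -ij !eqxx.
Qed.

Lemma descents_sum n (s : 'S_n.+1) : descents s = \sum_(k < n) descent_at s k.
Proof.
rewrite /descents -sum1_card big_mkcond /= big_ord_recr /= [X in _ + X](_ : _ = 0); last first.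
  rewrite inE; case: existsP => // -[j /andP[/eqP ij _]].
  by have := ltn_ord j; rewrite ij ltnn.
rewrite addn0; apply: eq_bigr => k _; rewrite inE.
have lt : k.+1 < n.+1 by rewrite ltnS.
rewrite -[X in descent_at s X]/(val (widen_ord (leqnSn n) k)).
rewrite (@descent_atE _ _ _ (Ordinal lt)) //.
suff -> : [exists j : 'I_n.+1, (val j == k.+1) && (s j < s (widen_ord (leqnSn n) k))]
   = (s (Ordinal lt) < s (widen_ord (leqnSn n) k)) by case: (_ < _).
apply/existsP/idP => [[j /andP[/eqP ij]]|]; last by exists (Ordinal lt); rewrite eqxx.
by have -> : j = Ordinal lt by apply: val_inj.
Qed.

Lemma non_descents_descents n (s : 'S_n.+1) :
  non_descents (descent_at s) n + descents s = n.
Proof.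
rewrite descents_sum /non_descents -big_split /= -[RHS]card_ord -sum1_card.
by apply: eq_bigr => i _; case: descent_at.
Qed.

(** Read in the order given by [s^-1], the letters must increase weakly; a tie is allowed only where
    the positions ascend, so each descent of [s^-1] forces a strict step. *)
Lemma std_eq_step n (g : 'I_n -> nat) (s : 'S_n) :
  (std g == s) = [forall i, forall j, (val j == (val i).+1) ==>
     (g ((s^-1)%g i) + descent_at (s^-1)%g i <= g ((s^-1)%g j))].
Proof.
set x := (s^-1)%g.
have stepE i j : val j = (val i).+1 ->
    (g (x i) + descent_at x i <= g (x j)) = lex_lt g (x i) (x j).
  move=> ij; rewrite (descent_atE _ ij) /lex_lt.
  have : x i != x j :> nat.
    by rewrite (inj_eq val_inj) (inj_eq perm_inj) -(inj_eq val_inj) ij neq_ltn ltnSn.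
  by case: (ltngtP (x i) (x j)) => //=; lia.
apply/eqP/forallP => [E i|H].
  apply/forallP => j; apply/implyP => /eqP ij.
  by rewrite stepE // -std_ltE E /x !permKV ij.
have {}H (i j : 'I_n) : i < j -> lex_lt g (x i) (x j).
  move=> ij; have [k jE] : exists k, val j = i + k.+1.
    by exists (j - i.+1); rewrite subnSK // subnKC // ltnW.
  elim: k => [|k IH] in j jE {ij} *.
    have ij : val j = (val i).+1 by rewrite jE addn1.
    by rewrite -stepE //; have /forallP/(_ j) := H i; rewrite ij eqxx.
  have lt : i + k.+1 < n by have := ltn_ord j; rewrite jE; lia.
  apply: (lex_lt_trans (IH (Ordinal lt) erefl)).
  have ij : val j = (val (Ordinal lt)).+1 by rewrite jE addnS.
  by rewrite -stepE //; have /forallP/(_ j) := H (Ordinal lt); rewrite ij eqxx.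
apply: std_unique => p q; case: (ltngtP (s p) (s q)) => [/H|/H|/val_inj/perm_inj->].
- by rewrite /x !permK => ->.
- rewrite /x !permK => qp; rewrite lex_lt_total ?qp //.
  by apply: contraTneq qp => ->; rewrite lex_ltnn.
- by rewrite lex_ltnn.
Qed.

(** Reindexing the words along [s] turns the condition of [std_eq_step] into that of
    [card_step_words]. *)
Lemma nstdE n c (s : 'S_n.+1) :
  nstd c s = 'C(c + (n - descents (s^-1)%g), n.+1).
Proof.
rewrite -{2}(non_descents_descents (s^-1)%g) addnK -card_step_words.
pose F (g : {ffun 'I_n.+1 -> 'I_c}) := [ffun p => g (s p)].
have F_bij : bijective F.
  exists (fun f : {ffun 'I_n.+1 -> 'I_c} => [ffun i => f ((s^-1)%g i)]) => f; apply/ffunP => i;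
    by rewrite !ffunE ?permK ?permKV.
rewrite /nstd -sum1_card (reindex _ (onW_bij _ F_bij)) sum1_card /=.
apply: eq_card => f; rewrite -[LHS]/(std (fun p => F f p) == s) std_eq_step inE.
by apply: eq_forallb => i; apply: eq_forallb => j; rewrite !ffunE !permKV.
Qed.

Lemma descents_leq n (s : 'S_n.+1) : descents s <= n.
Proof. by rewrite -[X in _ <= X](non_descents_descents s) leq_addl. Qed.

(** * Inversion of binomial sums *)

Local Open Scope ring_scope.

(** The coefficient of [z^k] in [(1 - z)^N] times the generating series of [f]. *)
Definition alt_sum (R : comPzRingType) (N : nat) (f : nat -> R) (k : nat) : R :=
  \sum_(l < k.+1) (-1) ^+ l * ('C(N, l))%:R * f (k - l)%N.

Lemma alt_sumS (R : comPzRingType) N (f : nat -> R) k :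
  alt_sum N.+1 f k.+1 = alt_sum N f k.+1 - alt_sum N f k.
Proof.
rewrite /alt_sum big_ord_recl [in RHS]big_ord_recl !bin0 -addrA; congr (_ + _).
rewrite -sumrB; apply: eq_bigr => i _.
by rewrite lift0 binS natrD subSS exprS; ring.
Qed.

Lemma alt_sumB (R : comPzRingType) N (f g : nat -> R) k :
  alt_sum N (fun i => f i - g i) k = alt_sum N f k - alt_sum N g k.
Proof.
by rewrite /alt_sum -sumrB; apply: eq_bigr => i _; rewrite mulrBr.
Qed.

Lemma alt_sum_shift (R : comPzRingType) N (f : nat -> R) k :
  alt_sum N f k = alt_sum N (fun m => if m is m'.+1 then f m' else 0) k.+1.
Proof.
rewrite /alt_sum [in RHS]big_ord_recr /= subnn mulr0 addr0.
by apply: eq_bigr => i _; rewrite subSn // -ltnS.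
Qed.

(* Coefficientwise form of [(1 - z)^(n+1) * (z^d / (1 - z)^(n+1)) = z^d]. *)
Lemma alt_sum_bin (R : comPzRingType) n d k :
  alt_sum n.+1 (fun m => if (d <= m)%N then ('C(n + (m - d), n))%:R else 0 : R) k
  = (d == k)%:R.
Proof.
elim: n => [|n IH] in k *; case: k => [|k].
- by rewrite /alt_sum big_ord1 bin0 expr0 !mul1r leqn0; case: d.
- have alt0 f m : @alt_sum R 0 f m = f m.
    rewrite /alt_sum big_ord_recl big1 ?addr0 ?bin0 ?expr0 ?mul1r ?subn0 //.
    by move=> i _; rewrite bin0n mulr0 mul0r.
  rewrite alt_sumS !alt0 !bin0.
  by case: (ltngtP d k.+1) => [lt|lt|->]; rewrite ?ltnn ?subr0 //;
    [have -> : (d <= k)%N by lia | have -> : (d <= k)%N = false by lia]; rewrite subrr.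
- by rewrite /alt_sum big_ord1 bin0 expr0 !mul1r leqn0; case: (d) => [|d0] //=; rewrite addn0 binn.
(* One factor [1 - z] is moved onto the sequence, where Pascal's rule lowers [n.+1] to [n]. *)
rewrite alt_sumS [X in _ - X]alt_sum_shift -alt_sumB -IH.
apply: eq_bigr => l _; congr (_ * _); move: (_ - _)%N => [|m] /=.
  by rewrite subr0 leqn0; case: (d) => [|d0] //=; rewrite !addn0 !binn.
case: (ltngtP d m.+1) => [lt|lt|->].
- have -> : (d <= m)%N by lia.
  by rewrite subSn // addnS binS natrD addrAC subrr add0r addSnnS.
- by rewrite leqNgt (ltnW lt) subr0.
- by rewrite ltnn subnn !addn0 !binn subr0.
Qed.

(** * From the shuffle measure to the carries matrix *)

Lemma QbE n b (s : 'S_n.+1) : Qb b s = (nstd b s)%:R / (b ^ n.+1)%:R.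
Proof.
by rewrite /Qb nstdE; congr (_%:R / _); congr 'C(_, _); have := descents_leq (s^-1)%g; lia.
Qed.

Lemma Qb_ge0 n b (s : 'S_n) : 0 <= Qb b s.
Proof. by rewrite divr_ge0 ?ler0n. Qed.

Lemma sum_Qb n b : (0 < b)%N -> \sum_(s : 'S_n.+1) Qb b s = 1.
Proof.
move=> b0; under eq_bigr do rewrite QbE.
rewrite -mulr_suml -natr_sum sum_nstd divff // pnatr_eq0 expn_eq0; lia.
Qed.

(** By [nstdE] the counts [nstd (m.+1) t] are the binomials of [alt_sum_bin] with [d] the number of
    descents of [t^-1]; they vanish for [m < d]. *)
Lemma descents_indicator (R : comPzRingType) n (t : 'S_n.+1) i :
  (descents (t^-1)%g == i)%:R =
  \sum_(l < i.+1) (-1) ^+ l * ('C(n.+2, l))%:R * (nstd (i.+1 - l) t)%:R :> R.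
Proof.
rewrite -(alt_sum_bin _ n.+1); apply: eq_bigr => l _; congr (_ * _).
have dn := descents_leq (t^-1)%g.
rewrite nstdE subSn -1?ltnS //; move: (i - l)%N => m /=; case: leqP => dm.
  by rewrite bin_small //; lia.
by congr (_%:R); congr 'C(_, _); lia.
Qed.

(** After expanding the indicator and exchanging sums, [nstd_conv] evaluates the sum over [t] as
    [nstd ((i.+1 - l) * b) s], an explicit binomial. *)
Lemma sum_Qb_descents n b (s : 'S_n.+1) i : (0 < b)%N ->
  \sum_(t : 'S_n.+1 | descents (t^-1)%g == i) Qb b (s * t^-1)%g
  = Pb n.+1 b (descents (s^-1)%g) i.
Proof.
move=> b0; have dn := descents_leq (s^-1)%g; set d := descents _ in dn *.
transitivity (\sum_(l < i.+1) (-1) ^+ l * ('C(n.+2, l))%:R *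
    ('C(n.+1 - 1 - d + (i.+1 - l) * b, n.+1))%:R / (b ^ n.+1)%:R : rat).
  rewrite big_mkcond /=.
  under eq_bigr => t _.
    rewrite QbE (_ : (if _ then _ else _) = (nstd b (s * t^-1)%g)%:R / (b ^ n.+1)%:R *
      (descents (t^-1)%g == i)%:R); last by case: ifP; rewrite ?mulr1 ?mulr0.
    rewrite descents_indicator mulr_sumr.
    over.
  rewrite exchange_big /=; apply: eq_bigr => l _.
  have -> : 'C(n.+1 - 1 - d + (i.+1 - l) * b, n.+1) = nstd ((i.+1 - l) * b) s.
    by rewrite nstdE -/d; congr 'C(_, _); lia.
  rewrite -nstd_conv natr_sum mulr_sumr mulr_suml; apply: eq_bigr => t _.
  by rewrite natrM; ring.
(* The sum in [Pb] stops earlier; beyond its bound [(i.+1 - l) * b <= d], so the upper index of the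
   binomial is at most [n] and the extra terms vanish. *)
rewrite -mulr_suml /Pb; congr (_ / _); rewrite [RHS](big_ord_widen i.+1 (fun l =>
  (-1) ^+ l * ('C(n.+2, l))%:R * ('C(n.+1 - 1 - d + (i.+1 - l) * b, n.+1))%:R)) ?leq_subr //.
rewrite [RHS]big_mkcond /=; apply: eq_bigr => l _; case: ifP => // ld.
rewrite [X in _ * X%:R]bin_small ?mulr0 //.
have : ((i.+1 - l) * b <= d)%N.
  by apply: leq_trans (leq_trunc_div d b); rewrite leq_mul2r leq_subCl leqNgt ld orbT.
by rewrite -(leq_add2l (n.+1 - 1 - d)) => /leq_ltn_trans; apply; lia.
Qed.

(** * Joint law of the descent path and the arrangement *)

Definition on_path n (js : seq nat) (mu : seq 'S_n) : bool :=
  all (fun k => descents (tau mu k)^-1%g == nth 0%N js k) (iota 0 (size js)).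

Lemma pathprobE n b r (js : seq 'I_n) : size js = r.+1 ->
  pathprob b js = \sum_(mu : r.-tuple 'S_n)
    (\prod_(m <- mu) Qb b m) * (on_path (map val js) mu)%:R.
Proof.
move=> sz; have -> : r = (size js).-1 by rewrite sz.
apply: eq_bigr => mu _; congr (_ * _).
suff -> : on_path (map val js) mu =
    [forall k : 'I_(size js), descents (tau mu k)^-1%g == nth 0%N (map val js) k]
  by case: ifP.
rewrite /on_path size_map; apply/allP/forallP => H k; first by apply: H; rewrite mem_iota /=.
by rewrite mem_iota /= => lt; apply: (H (Ordinal lt)).
Qed.

Lemma tau_rcons n (mu : seq 'S_n) m :
  tau (rcons mu m) (size mu).+1 = (m * tau mu (size mu))%g.
Proof. by rewrite /tau !take_oversize ?size_rcons // foldl_rcons. Qed.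

Lemma on_path_rcons n js j (mu : seq 'S_n) m : size js = (size mu).+1 ->
  on_path (rcons js j) (rcons mu m) =
  on_path js mu && (descents (m * tau mu (size mu))^-1%g == j).
Proof.
move=> sz; rewrite /on_path size_rcons -[X in iota 0 X]addn1 iotaD all_cat /= andbT add0n.
rewrite nth_rcons ltnn eqxx {2}sz tau_rcons; congr (_ && _).
apply: eq_in_all => k; rewrite mem_iota add0n /= => lt.
by rewrite nth_rcons lt /tau -cats1 takel_cat // -ltnS -sz.
Qed.

Lemma sum_tuple_rcons (R : nmodType) (T : finType) r (F : seq T -> R) :
  \sum_(mu : r.+1.-tuple T) F mu = \sum_(mu : r.-tuple T) \sum_m F (rcons mu m).
Proof.
rewrite pair_big /= (reindex (fun p : r.-tuple T * T => [tuple of rcons p.1 p.2])) //=.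
apply: onW_bij; apply: inj_card_bij; last by rewrite card_prod !card_tuple expnSr.
by move=> [mu m] [mu' m'] /(congr1 val) /= /rcons_inj [/val_inj -> ->].
Qed.

(** Keeping the final arrangement [s] makes a recursion on [r] possible. *)
Definition path_law n b r (js : seq nat) (s : 'S_n) : rat :=
  \sum_(mu : r.-tuple 'S_n)
    (\prod_(m <- mu) Qb b m) * (on_path js mu && (tau mu r == s))%:R.

Lemma pathprob_law n b r (js : seq 'I_n) : size js = r.+1 ->
  pathprob b js = \sum_(s : 'S_n) path_law b r (map val js) s.
Proof.
move=> sz; rewrite (pathprobE _ sz) exchange_big; apply: eq_bigr => mu _ /=.
rewrite (bigD1 (tau mu r)) //= eqxx andbT [X in _ + X]big1 ?addr0 // => s.
by rewrite eq_sym => /negbTE ->; rewrite andbF mulr0.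
Qed.

Lemma path_law_rcons n b r js j (s : 'S_n) : size js = r.+1 ->
  path_law b r.+1 (rcons js j) s =
  (descents s^-1%g == j)%:R * \sum_t path_law b r js t * Qb b (s * t^-1)%g.
Proof.
move=> sz; rewrite /path_law (sum_tuple_rcons _ (fun mu : seq 'S_n =>
  \prod_(m <- mu) Qb b m * (on_path (rcons js j) mu && (tau mu r.+1 == s))%:R)).
under [in RHS]eq_bigr do rewrite mulr_suml.
rewrite [in RHS]exchange_big mulr_sumr; apply: eq_bigr => mu _ /=.
have muE : size mu = r by rewrite size_tuple.
set t0 := tau mu r.
(* Exactly one last shuffle leads from [t0] to [s], so the sum over [m] has one nonzero term, as
   does the sum over [t]. *)
have stepE m : on_path (rcons js j) (rcons mu m) && (tau (rcons mu m) r.+1 == s) =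
    [&& on_path js mu, descents s^-1%g == j & m == (s * t0^-1)%g].
  have tauE : tau (rcons mu m) r.+1 = (m * t0)%g by have := tau_rcons mu m; rewrite muE.
  rewrite on_path_rcons ?muE // tauE -/t0 -andbA; congr (_ && _).
  rewrite (can2_eq (mulgK t0) (mulgKV t0)).
  by case: (m =P _) => [->|]; rewrite ?andbF // mulgKV.
rewrite (bigD1 (s * t0^-1)%g) //= [X in _ + X]big1 => [|m /negbTE nm]; last
  by rewrite stepE nm !andbF mulr0.
rewrite [in RHS](bigD1 t0) //= [X in _ = _ * (_ + X)]big1 => [|t]; last first.
  by rewrite eq_sym => /negbTE nt; rewrite nt andbF mulr0 mul0r.
rewrite stepE !eqxx !andbT !addr0 big_rcons /= -mulnb natrM; ring.
Qed.

(** A constant word standardizes to [u^-1] for every [u] without descents, so all such [u] coincide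
    with the identity. *)
Lemma descents_eq0 n (s : 'S_n) : (descents s == 0%N) = (s == 1%g).
Proof.
have d0 (u : 'S_n) : descents u = 0%N -> std (fun=> 0%N) = (u^-1)%g.
  move=> /card0_eq u0; apply/eqP; rewrite std_eq_step invgK.
  apply/forallP => i; apply/forallP => j; apply/implyP => /eqP ij; rewrite (descent_atE _ ij).
  have -> // : (u j < u i)%N = false.
  apply: contraFF (u0 i) => lt; rewrite inE; apply/existsP; exists j.
  by rewrite ij eqxx.
have d1 : descents (1%g : 'S_n) = 0%N.
  apply: eq_card0 => i; rewrite inE; apply/existsP => -[j /andP[/eqP ij]].
  by rewrite !perm1 ij ltnNge leqnSn.
apply/eqP/eqP => [/d0|-> //]; by rewrite (d0 _ d1) => /invg_inj.
Qed.

(** This uniformity on inverse descent classes is what makes the descent process Markov. *)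
Lemma path_law_uniform n b r js i : (0 < b)%N -> size js = r ->
  exists c : rat, forall s : 'S_n.+1,
    path_law b r (rcons js i) s = c * (descents s^-1%g == i)%:R.
Proof.
move=> b0; elim: r js i => [|r IH] js i.
  move=> /size0nil ->; exists (i == 0%N)%:R => s.
  rewrite /path_law (big_pred1 [tuple]) => [|mu]; last by rewrite [mu]tuple0; apply/esym/eqP.
  rewrite big_nil mul1r /on_path /= andbT /tau /= invg1 -natrM mulnb.
  rewrite (eqP (_ : descents 1%g == 0%N)) ?descents_eq0 //.
  rewrite eq_sym; case: eqP => //= ->.
  by rewrite descents_eq0 invg_eq1 eq_sym.
case: (lastP js) => // js' k; rewrite size_rcons => -[sz].
have [c Hc] := IH _ k sz.
(* By induction the sum over [t] is [c] times the sum of [Qb] over the class [k], which depends on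
   [s] only through its class [i]. *)
exists (c * Pb n.+1 b i k) => s; rewrite path_law_rcons ?size_rcons ?sz //.
case: eqP => [<-|]; rewrite ?mul0r ?mulr0 // mul1r mulr1 -(sum_Qb_descents _ _ b0).
rewrite mulr_sumr [RHS]big_mkcond; apply: eq_bigr => t _.
by rewrite Hc; case: ifP; rewrite ?mulr1 ?mulr0 ?mul0r.
Qed.

(** * Eulerian numbers and their positivity *)

Lemma eulerianE n j : (eulerian n j)%:R = \sum_(s : 'S_n) (descents s^-1%g == j)%:R :> rat.
Proof.
rewrite (reindex_inj invg_inj) /eulerian -sum1_card natr_sum big_mkcond /=.
by apply: eq_bigr => s _; rewrite invgK inE; case: eqP.
Qed.

Lemma flip_inj n (i : 'I_n) : injective (fun k : 'I_n =>
  if (k <= i)%N then Ordinal (leq_ltn_trans (leq_subr k i) (ltn_ord i)) else k).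
Proof.
move=> k l; case: (leqP k i) => ki; case: (leqP l i) => li /(congr1 val) /= E;
  apply: val_inj => /=; lia.
Qed.

(* Reversing the initial segment [0 .. i] yields exactly [i] descents. *)
Lemma eulerian_gt0 n (i : 'I_n) : (0 < eulerian n i)%N.
Proof.
apply/card_gt0P; exists (perm (@flip_inj n i)); rewrite inE.
rewrite -[X in _ == X]card_ltn_ord; apply/eqP/eq_card => k; rewrite !inE.
apply/existsP/idP => [[l /andP[/eqP /= lk]]|ki].
  by rewrite !permE /=; case: (leqP l i) => li; case: (leqP k i) => ki /=; lia.
exists (Ordinal (leq_ltn_trans ki (ltn_ord i))); rewrite eqxx !permE /= ki (ltnW ki) /=.
lia.
Qed.

(** * The Markov chain, its stationary law and its reversal *)

Unset Implicit Arguments.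

Theorem theorem2p2 (n b : nat) (hn : (2 <= n)%N) (hb : (2 <= b)%N) :
  exists K : 'I_n -> 'I_n -> rat,
    (* K is a transition matrix on {0,...,n-1} *)
    (forall i j, 0 <= K i j) /\ (forall i, \sum_j K i j = 1) /\
    (* (d(tau_r^-1))_r is a Markov chain with transition matrix K *)
    (forall (js : seq 'I_n) (i j : 'I_n),
        pathprob b (rcons js i ++ [:: j]) = pathprob b (rcons js i) * K i j) /\
    (* pi is stationary for K *)
    (forall j : 'I_n, \sum_(i : 'I_n) pi_eul n i * K i j = pi_eul n j) /\
    (* time reversal of K w.r.t. pi is the carries chain *)
    (forall i j : 'I_n, K i j = pi_eul n j * Pb n b j i / pi_eul n i).
Proof.
case: n hn => // n _; have b0 : (0 < b)%N by apply: ltnW.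
pose A (i : 'I_n.+1) : rat := (eulerian n.+1 i)%:R.
have A_neq0 i : A i != 0 by rewrite pnatr_eq0 -lt0n eulerian_gt0.
have fact_neq0 : ((n.+1)`!)%:R != 0 :> rat by rewrite pnatr_eq0 -lt0n fact_gt0.
have pi_neq0 (i : 'I_n.+1) : pi_eul n.+1 i != 0.
  by apply: mulf_neq0; [exact: A_neq0 | rewrite invr_neq0].
have PbE (s : 'S_n.+1) i : Pb n.+1 b (descents s^-1%g) i =
    \sum_(t : 'S_n.+1 | descents t^-1%g == i) Qb b (s * t^-1)%g.
  by rewrite sum_Qb_descents.
have sum_cond (F : 'S_n.+1 -> rat) :
    \sum_(i < n.+1) \sum_(s : 'S_n.+1 | descents s^-1%g == i) F s = \sum_s F s.
  have dlt (s : 'S_n.+1) : (descents s^-1%g < n.+1)%N by rewrite ltnS descents_leq.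
  by rewrite [RHS](partition_big (fun s => Ordinal (dlt s)) xpredT).
have AE i : A i = \sum_(s : 'S_n.+1 | descents s^-1%g == i) 1.
  rewrite /A eulerianE [RHS]big_mkcond; apply: eq_bigr => s _; by case: eqP.
have A_Pb i j : A j * Pb n.+1 b j i =
    \sum_(s : 'S_n.+1 | descents s^-1%g == j) \sum_(t : 'S_n.+1 | descents t^-1%g == i)
       Qb b (s * t^-1)%g.
  by rewrite AE mulr_suml; apply: eq_bigr => s /eqP <-; rewrite mul1r PbE.
(* A representative of the nonempty class [j] turns the row sum into the total mass of [Qb]. *)
have Pb_row (j : 'I_n.+1) : \sum_(i < n.+1) Pb n.+1 b j i = 1.
  have /card_gt0P[s] := eulerian_gt0 j; rewrite inE => /eqP <-.
  rewrite -[s]invgK; under eq_bigr do rewrite PbE.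
  rewrite sum_cond -[RHS](sum_Qb n b0) [RHS](reindex_inj (mulgI s^-1%g)) /=.
  by rewrite (reindex_inj invg_inj) /=; apply: eq_bigr => t _; rewrite invgK.
exists (fun i j => pi_eul n.+1 j * Pb n.+1 b j i / pi_eul n.+1 i).
have KE (i j : 'I_n.+1) : pi_eul n.+1 j * Pb n.+1 b j i / pi_eul n.+1 i =
    A j * Pb n.+1 b j i / A i.
  by rewrite /pi_eul -!/(A _); field; rewrite fact_neq0 A_neq0.
split=> [i j|].
  rewrite KE A_Pb mulr_ge0 ?invr_ge0 ?ler0n //.
  by apply: sumr_ge0 => s _; apply: sumr_ge0 => t _; apply: Qb_ge0.
split=> [i|].
  under eq_bigr do rewrite KE A_Pb.
  (* For fixed [t] the sum over all [s] is the total mass of [Qb], which leaves [A i / A i]. *)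
  rewrite -mulr_suml sum_cond exchange_big /=.
  rewrite (eq_bigr (fun=> 1)) -?AE ?divff // => t _.
  by rewrite -(sum_Qb n b0) [RHS](reindex_inj (mulIg t^-1%g)).
split=> [js i j|].
  (* The path has probability [c * A i], and its extension by [j] has
     [c * (A j * Pb n.+1 b j i)]. *)
  have [c Hc] := path_law_uniform n i b0 (size_map val js).
  rewrite cats1 KE (@pathprob_law _ _ (size js).+1) ?size_rcons //.
  rewrite (@pathprob_law _ _ (size js)) ?size_rcons // !map_rcons.
  have -> : \sum_(s : 'S_n.+1) path_law b (size js) (rcons (map val js) (val i)) s = c * A i.
    by rewrite /A eulerianE mulr_sumr; apply: eq_bigr => s _; rewrite Hc.
  transitivity (c * (A j * Pb n.+1 b j i)); last by field; rewrite A_neq0.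
  rewrite A_Pb mulr_sumr [RHS]big_mkcond; apply: eq_bigr => s _.
  rewrite path_law_rcons ?size_rcons ?size_map //.
  case: ifP => _; rewrite ?mul0r // mul1r mulr_sumr [RHS]big_mkcond.
  by apply: eq_bigr => t _; rewrite Hc; case: ifP; rewrite ?mulr1 ?mulr0 ?mul0r.
split=> // j.
under eq_bigr => i _ do rewrite mulrCA divff // mulr1.
by rewrite -mulr_sumr Pb_row mulr1.
Qed.
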